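(* Let $D_0$ be the edge-ordered graph on the four vertices $a,b,v,w$ with exactly the five edges $ab,av,aw,bw,bv$, ordered by $l(ab)<l(av)<l(aw)<l(bw)<l(bv)$. Let $G$ be a fixed edge-ordered graph, and let $D_0+G$ be the vertex-disjoint union of $D_0$ and $G$, edge-ordered so that $l(D_0)<l(G)$ (and with the given orders on $D_0$ and $G$). Then \[\Omega(n\sqrt{\log n})=ssat_m(n,D_0+G)\ \le\ sat_m(n,D_0+G)=O\left(n\,\frac{\log n}{\log\log n}\right).\]
   Context: An edge-ordered graph is a finite simple graph together with a linear order on its edge set given by an injective labeling $l$ to $\mathbb{N}$ or $\mathbb{R}$. An edge-ordered graph $H$ contains $F$ (has a copy of $F$) if $F$ is isomorphic, by an isomorphism respecting the edge-order, to a subgraph of $H$ with the induced order; otherwise $H$ is $F$-free. $l(F_1)<l(F_2)$ means that all labels of edges of $F_1$ are smaller than all labels of edges of $F_2$. $ssat_m(n,F)$ is the minimum number of edges in an edge-ordered graph $H$ on $n$ vertices such that adding to $H$ any missing edge, inserted at the beginning of the linear order (i.e. with a label smaller than all labels of $H$), creates a new copy of $F$ (one using the added edge). $sat_m(n,F)$ is defined in the same way with the additional requirement that $H$ is $F$-free. Asymptotic notation is for $n\to\infty$ with $G$ fixed; ''$\Omega(f)=g$'' means $g=\Omega(f)$. *)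

(* Defs.v *)
From mathcomp Require Import all_boot.
From mathcomp Require Import boolp.

Set Implicit Arguments.
Unset Strict Implicit.
Unset Printing Implicit Defensive.

(* Edges are two-element vertex sets. Only the values of [lab] on [edges]
   are meaningful. *)
Record eograph (V : finType) := EOGraph {
  edges : {set {set V}};
  lab : {set V} -> nat;
  card_edge : {in edges, forall e : {set _}, #|e| = 2};
  lab_inj : {in edges &, injective lab}
}.

(* [phi] is an isomorphism from F onto the subgraph of H with vertex set
   [phi @: W] and edge set [[set phi @: e | e in edges F]], and it preserves the
   edge order. *)
Definition is_copy (W V : finType) (F : eograph W) (H : eograph V)
    (phi : W -> V) : Prop :=
  [/\ injective phi,
      {in edges F, forall e : {set W}, phi @: e \in edges H} &
      {in edges F &, forall e f : {set W},
         lab F e < lab F f -> lab H (phi @: e) < lab H (phi @: f)}].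

Definition contains (W V : finType) (F : eograph W) (H : eograph V) : Prop :=
  exists phi : W -> V, is_copy F H phi.

Definition free (W V : finType) (F : eograph W) (H : eograph V) : Prop :=
  ~ contains F H.

(* Inserts e with a label below all labels of H; the labels of H are shifted by
   one to make room for it in [nat], which does not change their order. *)
Section AddFirst.
Variables (V : finType) (H : eograph V) (e : {set V}) (e2 : #|e| = 2).

Definition first_lab (f : {set V}) : nat := if f == e then 0 else (lab H f).+1.

Fact add_first_card : {in e |: edges H, forall f : {set _}, #|f| = 2}.
Proof. by move=> f /setU1P[->|/card_edge]. Qed.

Fact add_first_inj : {in e |: edges H &, injective first_lab}.
Proof.
move=> f g; rewrite /first_lab !inE.
case: (eqVneq f e) => [->|_]; case: (eqVneq g e) => [->|_] //= fH gH [].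
exact: lab_inj.
Qed.

Definition add_first : eograph V := EOGraph add_first_card add_first_inj.

End AddFirst.

(* Adding any missing edge at the beginning of the order creates a copy of F,
   that is, a copy using the added edge. *)
Definition semisaturated (W V : finType) (F : eograph W) (H : eograph V) :
    Prop :=
  forall (e : {set V}) (e2 : #|e| = 2), e \notin edges H ->
    exists2 phi : W -> V, is_copy F (add_first H e2) phi &
      exists2 f, f \in edges F & phi @: f = e.

(* Minimum of a set of natural numbers; the value 0 on the empty set is never
   used when F has an edge (see [ssat_m_attained], [sat_m_attained]). *)
Definition nat_min (P : nat -> Prop) : nat :=
  if pselect (exists k, `[< P k >]) is left h then ex_minn h else 0.

Definition ssat_m (W : finType) (n : nat) (F : eograph W) : nat :=
  nat_min (fun m => exists H : eograph 'I_n,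
    semisaturated F H /\ #|edges H| = m).

Definition sat_m (W : finType) (n : nat) (F : eograph W) : nat :=
  nat_min (fun m => exists H : eograph 'I_n,
    [/\ free F H, semisaturated F H & #|edges H| = m]).

(* Vertex-disjoint union: the labels of G are shifted above those of F. *)
Section DisjointUnion.
Variables (V W : finType) (F : eograph V) (G : eograph W).

Local Notation inlV := (@inl V W).
Local Notation inrW := (@inr V W).

Definition lab_bound : nat := \max_(e in edges F) (lab F e).+1.

Definition dunion_edges : {set {set V + W}} :=
  [set inlV @: e | e : {set V} in edges F] :|:
  [set inrW @: e | e : {set W} in edges G].

Definition dunion_lab (e : {set V + W}) : nat :=
  if e \in [set inlV @: f | f : {set V} in edges F] then lab F (inlV @^-1: e)
  else lab_bound + lab G (inrW @^-1: e).

Let inlV_inj : injective inlV. Proof. by move=> x y []. Qed.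
Let inrW_inj : injective inrW. Proof. by move=> x y []. Qed.

Let preim_inj (A B : finType) (h : A -> B) : injective h ->
  forall X : {set A}, h @^-1: (h @: X) = X.
Proof. by move=> hI X; apply/setP => x; rewrite inE mem_imset. Qed.

Fact dunion_card : {in dunion_edges, forall e : {set _}, #|e| = 2}.
Proof.
by move=> _ /setUP[] /imsetP[e eE ->]; rewrite card_imset // (card_edge eE).
Qed.

Fact dunion_inl (e : {set V}) : e \in edges F ->
  dunion_lab (inlV @: e) = lab F e.
Proof. by move=> eF; rewrite /dunion_lab imset_f ?preim_inj. Qed.

Fact dunion_inr (e : {set W}) : e \in edges G ->
  dunion_lab (inrW @: e) = lab_bound + lab G e.
Proof.
move=> eG; rewrite /dunion_lab preim_inj //; case: imsetP => // -[f fF ef].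
have /card_gt0P[x xe] : 0 < #|e| by rewrite (card_edge eG).
have : inrW x \in inlV @: f by rewrite -ef imset_f.
by case/imsetP.
Qed.

Fact lab_lt_bound (e : {set V}) : e \in edges F -> lab F e < lab_bound.
Proof. by move=> eF; rewrite /lab_bound (bigD1 e) //= leq_maxl. Qed.

Fact dunion_inj : {in dunion_edges &, injective dunion_lab}.
Proof.
move=> _ _ /setUP[] /imsetP[e eE ->] /setUP[] /imsetP[f fE ->];
  rewrite ?dunion_inl ?dunion_inr //.
- by move/(lab_inj eE fE)->.
- by move=> eq; have := lab_lt_bound eE; rewrite eq ltnNge leq_addr.
- by move=> eq; have := lab_lt_bound fE; rewrite -eq ltnNge leq_addr.
- by move/addnI/(lab_inj eE fE)->.
Qed.

Definition dunion : eograph (V + W)%type := EOGraph dunion_card dunion_inj.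

End DisjointUnion.

Definition va : 'I_4 := @Ordinal 4 0 isT.
Definition vb : 'I_4 := @Ordinal 4 1 isT.
Definition vv : 'I_4 := @Ordinal 4 2 isT.
Definition vw : 'I_4 := @Ordinal 4 3 isT.

(* In increasing order of labels. *)
Definition D0_seq : seq {set 'I_4} :=
  [:: [set va; vb]; [set va; vv]; [set va; vw]; [set vb; vw]; [set vb; vv]].

Fact D0_card : {in [set e in D0_seq], forall e : {set _}, #|e| = 2}.
Proof.
have D0_card2 : all (fun e : {set 'I_4} => #|e| == 2) D0_seq.
  by rewrite /= !cards2.
by move=> e; rewrite inE => /(allP D0_card2)/eqP.
Qed.

Fact D0_inj : {in [set e in D0_seq] &, injective (index^~ D0_seq)}.
Proof.
by move=> e f eD fD; apply: (index_inj set0); [move: eD | move: fD]; rewrite inE.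
Qed.

Definition D0 : eograph 'I_4 := EOGraph D0_card D0_inj.

Lemma D0_lab_lt :
  [/\ lab D0 [set va; vb] < lab D0 [set va; vv],
      lab D0 [set va; vv] < lab D0 [set va; vw],
      lab D0 [set va; vw] < lab D0 [set vb; vw] &
      lab D0 [set vb; vw] < lab D0 [set vb; vv]].
Proof.
have neq (A B : {set 'I_4}) x : x \in A -> x \notin B -> (A == B) = false.
  by move=> xA; apply: contraNF => /eqP <-.
have D0_uniq : uniq D0_seq.
  have hb z : z \in [:: vv; vw] -> ([set va; vb] == [set va; z]) = false.
    by rewrite !inE => /pred2P[] ->; apply: (neq _ _ vb); rewrite !inE.
  have ha x z : z \in [:: vv; vw] ->
      ([set va; x] == [set vb; z]) = false.
    by rewrite !inE => /pred2P[] ->;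
      apply: (neq _ _ va); rewrite !inE.
  have hv : ([set va; vv] == [set va; vw]) = false.
    by apply: (neq _ _ vv); rewrite !inE.
  have hw : ([set vb; vw] == [set vb; vv]) = false.
    by apply: (neq _ _ vw); rewrite !inE.
  by rewrite /= !inE !hb ?ha ?hv ?hw ?inE.
have idx k : k < 5 -> index (nth set0 D0_seq k) D0_seq = k.
  by move=> k5; rewrite index_uniq.
have labE k : k < 5 -> lab D0 (nth set0 D0_seq k) = k by exact: idx.
by have := (labE 0 isT, labE 1 isT, labE 2 isT, labE 3 isT, labE 4 isT)
  => -[[[[/= -> ->] ->] ->] ->].
Qed.

Lemma nat_minP (P : nat -> Prop) : (exists k, P k) ->
  P (nat_min P) /\ forall k, P k -> nat_min P <= k.
Proof.
move=> [k Pk]; rewrite /nat_min; case: pselect => [h|[]]; last first.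
  by exists k; apply/asboolP.
case: ex_minnP => m /asboolP Pm min_m; split=> // j Pj.
exact/min_m/asboolP.
Qed.

Lemma ssat_m_attained (W : finType) (n : nat) (F : eograph W) :
  exists H : eograph 'I_n, semisaturated F H /\ #|edges H| = ssat_m n F.
Proof.
have c2 : {in [set e : {set 'I_n} | #|e| == 2], forall e : {set _}, #|e| = 2}.
  by move=> e; rewrite inE => /eqP.
have li : {in [set e : {set 'I_n} | #|e| == 2] &,
    injective (fun e => enum_rank e : nat)}.
  by move=> e f _ _ /val_inj/enum_rank_inj.
have [|//] := @nat_minP (fun m => exists H : eograph 'I_n,
  semisaturated F H /\ #|edges H| = m).
exists #|[set e : {set 'I_n} | #|e| == 2]|.
by exists (EOGraph c2 li); split=> // e e2; rewrite inE e2 eqxx.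
Qed.

Lemma sat_m_attained (W : finType) (n : nat) (F : eograph W) :
  edges F != set0 -> exists H : eograph 'I_n,
    [/\ free F H, semisaturated F H & #|edges H| = sat_m n F].
Proof.
move=> /set0Pn[f0 f0F].
have [|//] := @nat_minP (fun m => exists H : eograph 'I_n,
  [/\ free F H, semisaturated F H & #|edges H| = m]).
pose P k := `[< exists H : eograph 'I_n, free F H /\ #|edges H| = k >].
have exP : exists k, P k.
  have c2 : {in (set0 : {set {set 'I_n}}), forall e : {set _}, #|e| = 2}.
    by move=> e; rewrite inE.
  have li : {in (set0 : {set {set 'I_n}}) &, injective (fun=> 0)}.
    by move=> e; rewrite inE.
  exists 0; apply/asboolP; exists (EOGraph c2 li); rewrite cards0; split=> //.
  by case=> phi [_ /(_ _ f0F)]; rewrite inE.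
have bndP k : P k -> k <= #|{: {set 'I_n}}|.
  by move=> /asboolP[H [_ <-]]; apply: max_card.
case: (ex_maxnP exP bndP) => k /asboolP[H [HF Hk]] maxk.
exists k, H; split=> // e e2 eH; apply: contrapT => nocopy.
suff /maxk : P k.+1 by rewrite ltnn.
apply/asboolP; exists (add_first H e2); split; last first.
  by rewrite cardsU1 eH Hk.
move=> [phi cphi]; have [phiI phiE phiL] := cphi.
have ne f : f \in edges F -> phi @: f != e.
  by move=> fF; apply/eqP => fe; apply: nocopy; exists phi => //; exists f.
apply: HF; exists phi; split=> // [f fF|f g fF gF fg].
  by have := phiE _ fF; rewrite in_setU1 (negPf (ne _ fF)).
have := phiL _ _ fF gF fg.
by rewrite /= /first_lab (negPf (ne _ fF)) (negPf (ne _ gF)).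
Qed.

(* Main.v *)
(** Both bounds come from comparing, at each vertex x, the order of its edges
with a random or a prescribed order of its neighbours. The new edge xy can only
play the role of ab, so a missing edge xy forces common neighbours v, w with
xv < xw and yw < yv or vice versa: the edge orders at x and y disagree on {v,w}.

Lower bound: choose a tournament on the vertices at random. Two vertices whose
edge orders agree with it are adjacent, so the agreeing vertices of degree at
most D form a clique, of size at most D + 1; each of them agrees with
probability at least 2^(-D^2). Hence few vertices have degree below
c sqrt(log n).

Upper bound: join every other vertex to k hubs, where k! >= n, with pairwise
different orders of the hubs, consecutive blocks of labels for the vertices, and
put a copy of G above. This graph is free, as a bipartite graph has no triangle,
and two vertices with different orders of the hubs are saturated. The remaining
pairs, O(kn) of them, are added greedily at the beginning of the order when they
create no copy; this preserves the copies that saturate the other pairs. *)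

Require Import Defs.
From mathcomp Require Import all_boot perm zify.
From mathcomp Require Import boolp.

Set Implicit Arguments.
Unset Strict Implicit.
Unset Printing Implicit Defensive.

(** * Edges and labels of [D0] and of disjoint unions *)

Lemma imset_set2 (A B : finType) (f : A -> B) x y :
  f @: [set x; y] = [set f x; f y].
Proof. by rewrite imsetU1 imset_set1. Qed.

Lemma D0_lab_mono (L : {set 'I_4} -> nat) :
  L [set va; vb] < L [set va; vv] -> L [set va; vv] < L [set va; vw] ->
  L [set va; vw] < L [set vb; vw] -> L [set vb; vw] < L [set vb; vv] ->
  {in edges D0 &, forall e f, lab D0 e < lab D0 f -> L e < L f}.
Proof.
move=> L1 L2 L3 L4 e f; have [l1 l2 l3 l4] := D0_lab_lt; rewrite !inE.
by case/or4P=> [/eqP->|/eqP->|/eqP->|/orP[]/eqP->];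
  case/or4P=> [/eqP->|/eqP->|/eqP->|/orP[]/eqP->]; lia.
Qed.

Lemma dunion_edge_inlI (A B : finType) (F : eograph A) (G : eograph B)
  (e : {set A}) : e \in edges F -> inl @: e \in edges (dunion F G).
Proof. by move=> eF; apply/setUP; left; apply: imset_f. Qed.

Lemma D0_edge_ab : [set va; vb] \in edges D0.
Proof. by rewrite !inE eqxx. Qed.

Lemma ssat_m_le_sat_m (W : finType) (F : eograph W) n :
  edges F != set0 -> ssat_m n F <= sat_m n F.
Proof.
move=> /(sat_m_attained n)[H [_ Hsat <-]].
have [|_] := @nat_minP (fun m => exists H : eograph 'I_n,
  semisaturated F H /\ #|edges H| = m); first by exists #|edges H|, H.
by apply; exists H.
Qed.

(** * Lower bound: few vertices of a semisaturated graph have low degree *)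

Section Semisaturated.
Variables (V W : finType) (G : eograph W) (H : eograph V).

(** The added edge comes first in the order, so it must be the image of [ab], the first edge of the
    union. The other four edges of [D0] then map into [H], and their order gives the disagreement
    between x and y. *)
Lemma semisaturated_pair x y : semisaturated (dunion D0 G) H ->
  x != y -> [set x; y] \notin edges H -> exists v w,
  [/\ [set x; v] \in edges H, [set x; w] \in edges H,
      [set y; v] \in edges H & [set y; w] \in edges H] /\
  (lab H [set x; v] < lab H [set x; w]) && (lab H [set y; w] < lab H [set y;
    v]).
Proof.
move=> Hs xy xyH; have e2 : #|[set x; y]| = 2 by rewrite cards2 xy.
have [phi [phiI phiE phiL] [f fE phif]] := Hs _ e2 xyH.
have lE e (eD : e \in edges D0) := @dunion_inl _ _ D0 G e eD.
have iE e (eD : e \in edges D0) := dunion_edge_inlI G eD.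
have abE := D0_edge_ab.
have mE := iE _ abE.
(* Otherwise [ab] would precede f, and its image would have a label below 0, the label of the added
   edge. *)
have fab : f = inl @: [set va; vb].
  apply/eqP; apply: contraT => fab.
  have : lab (dunion D0 G) (inl @: [set va; vb]) < lab (dunion D0 G) f.
    rewrite ltn_neqAle; apply/andP; split.
      by apply: contra_neqN fab => /eqP/(lab_inj mE fE).
    rewrite [X in X <= _]/= lE ?inE ?eqxx //.
    by rewrite [X in X <= _](_ : _ = 0) //= eqxx.
  by move/(phiL _ _ mE fE); rewrite phif /= /first_lab eqxx ltn0.
pose p i := phi (inl i).
have pE i j : phi @: (inl @: [set i; j]) = [set p i; p j].
  by rewrite !imset_set2.
have xyE : [set p va; p vb] = [set x; y] by rewrite -pE -fab.
have [l1 l2 l3 l4] := D0_lab_lt.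
have inH g : g \in edges D0 -> lab D0 [set va; vb] < lab D0 g ->
    phi @: (inl @: g) \in edges H /\ phi @: (inl @: g) != [set x; y].
  move=> gE; rewrite -!lE // => /(phiL _ _ mE (iE _ gE)).
  have := phiE _ (iE _ gE); rewrite /= /first_lab !inE.
  by case: eqVneq.
have lt g h : g \in edges D0 -> h \in edges D0 ->
    lab D0 [set va; vb] < lab D0 g -> lab D0 g < lab D0 h ->
    lab H (phi @: (inl @: g)) < lab H (phi @: (inl @: h)).
  move=> gE hE lg lgh; have [_ /negPf gx] := inH _ gE lg.
  have [_ /negPf hx] := inH _ hE (ltn_trans lg lgh).
  move: lgh; rewrite -!lE // => /(phiL _ _ (iE _ gE) (iE _ hE)).
  by rewrite /= /first_lab gx hx.
have [avE awE] : [/\ [set va; vv] \in edges D0 & [set va; vw] \in edges D0].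
  by rewrite !inE !eqxx !orbT.
have [bwE bvE] : [/\ [set vb; vw] \in edges D0 & [set vb; vv] \in edges D0].
  by rewrite !inE !eqxx !orbT.
have l13 := ltn_trans l1 l2; have l14 := ltn_trans l13 l3.
have := (lt _ _ avE awE l1 l2, lt _ _ bwE bvE l14 l4).
have := (inH _ avE l1, inH _ awE l13, inH _ bwE l14, inH _ bvE (ltn_trans l14
  l4)).
rewrite !pE => -[[[[avH _] [awH _]] [bwH _]] [bvH _]] [lt1 lt2].
have : p va != p vb by rewrite (inj_eq phiI).
have xyz z : (z \in [set p va; p vb]) = (z \in [set x; y]) by rewrite xyE.
(* Either a goes to x and b to y, or the reverse; the reverse case exchanges the roles of v and
   w. *)
move=> ab; have := (xyz (p va), xyz (p vb)).
rewrite !inE !eqxx orbT /= => -[/esym/pred2P[]pa /esym/pred2P[]pb].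
- by rewrite pa pb eqxx in ab.
- by exists (p vv), (p vw); rewrite -pa -pb lt1 lt2.
- by exists (p vw), (p vv); rewrite -pa -pb lt1 lt2.
- by rewrite pa pb eqxx in ab.
Qed.

Definition nbrs (x : V) : {set V} := [set v | [set x; v] \in edges H].

Lemma sum_card_nbrs : \sum_x #|nbrs x| <= 2 * #|edges H|.
Proof.
have nbrsI x : #|nbrs x| <= #|[set e in edges H | x \in e]|.
  have inj : {in nbrs x &, injective (fun v => [set x; v])}.
    have xv v : v \in nbrs x -> v != x.
      by rewrite inE => /card_edge; rewrite cards2; case: eqVneq.
    move=> v w /xv vx _ /setP/(_ v); rewrite !inE eqxx orbT (negPf vx).
    by move/esym/eqP.
  rewrite -(card_in_imset inj); apply/subset_leq_card/subsetP => e /imsetP[v].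
  by rewrite !inE => vH ->; rewrite vH set21.
apply: leq_trans (leq_sum _ _) _ => [x _|]; first exact: nbrsI.
rewrite (eq_bigr (fun x => \sum_e (e \in [set f in edges H | x \in f])));
  last first.
  by move=> x _; rewrite -sum1_card big_mkcond.
rewrite exchange_big /= (bigID (mem (edges H))) /= [X in _ + X]big1 => [|e eH].
  rewrite addn0 mulnC -sum_nat_const leq_eqVlt; apply/orP; left; apply/eqP.
  apply: eq_bigr => e eH; rewrite -(card_edge eH) -sum1_card [RHS]big_mkcond.
  by apply: eq_bigr => x _; rewrite inE eH.
by apply: big1 => x _; rewrite inE (negPf eH).
Qed.

(** Pairs of a low-degree vertex x and a function f agreeing with x are counted twice: x fixes at
    most [D ^ 2] values of f, while each f agrees only with a clique of low-degree vertices. *)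
Lemma card_low_degree D : semisaturated (dunion D0 G) H ->
  #|[set x | #|nbrs x| <= D]| <= D.+1 * 2 ^ (D ^ 2).
Proof.
move=> Hs; set L := [set x | _].
(* The random tournament is an arbitrary Boolean function on ordered pairs. This makes [agree x] a
   product, whose size is read off coordinate by coordinate. *)
pose agree x : {set {ffun V * V -> bool}} := [set f : {ffun V * V -> bool} |
  f \in family (fun vw => if (vw.1 \in nbrs x) && (vw.2 \in nbrs x)
    then pred1 (lab H [set x; vw.1] < lab H [set x; vw.2]) else predT)].
have agree_large x : x \in L -> 2 ^ #|{: V * V}| <= #|agree x| * 2 ^ (D ^ 2).
  rewrite inE => dx; rewrite cardsE card_family foldrE big_map big_enum /=.
  set A := setX (nbrs x) (nbrs x).
  rewrite (bigID (mem A)) /= big1 => [|vw]; last first.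
    by rewrite !inE => ->; rewrite card1.
  rewrite mul1n (eq_bigr (fun=> 2)) => [|vw]; last first.
    by rewrite !inE => /negPf->; exact: card_bool.
  rewrite prod_nat_const -expnD leq_exp2l // -(cardC A) addnC leq_add //.
  by rewrite cardsX leq_mul.
have agree_clique f : #|[set x in L | f \in agree x]| <= D.+1.
  set C := [set x in L | _]; have [->|[x0]] := set_0Vmem C;
    first by rewrite cards0.
  rewrite inE => /andP[x0L fx0].
  have : C \subset x0 |: nbrs x0.
    apply/subsetP => x; rewrite !inE => /andP[xL fx].
    case: eqVneq => //= xx0; apply/negPn/negP => nadj.
    rewrite eq_sym in xx0.
    (* If x0 and x were not adjacent, f would have to be true at (v, w) for x0 and false for x. *)
    have [v [w [[xv xw yv yw] /andP[lx ly]]]] := semisaturated_pair Hs xx0 nadj.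
    move: fx0 fx; rewrite !inE => /familyP/(_ (v, w)) + /familyP/(_ (v, w)).
    rewrite /= !inE xv xw yv yw /= !inE lx => /eqP->.
    by rewrite ltnNge (ltnW ly).
  move/subset_leq_card/leq_trans; apply; rewrite cardsU1.
  by move: x0L; rewrite inE -ltnS; apply: leq_trans;
    rewrite -add1n leq_add2r leq_b1.
rewrite -(@leq_pmul2r (2 ^ #|{: V * V}|)) ?expn_gt0 //.
apply: (@leq_trans (\sum_(x in L) #|agree x| * 2 ^ (D ^ 2))).
  by rewrite -sum_nat_const; apply: leq_sum.
rewrite -big_distrl /= mulnAC leq_mul2r; apply/orP; right.
rewrite (eq_bigr (fun x => \sum_f (f \in agree x))); last first.
  by move=> x _; rewrite -sum1_card big_mkcond.
rewrite exchange_big /= -card_bool -card_ffun mulnC -sum_nat_const.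
apply: leq_sum => f _; apply: leq_trans (agree_clique f).
rewrite -big_mkcondr /= sum1_card; apply/subset_leq_card/subsetP => x.
by rewrite in_set.
Qed.

(** At most half of the vertices have degree below E. One factor 2 in the 4 comes from this half,
    the other from each edge having two ends. *)
Lemma semisaturated_edges_ge E : semisaturated (dunion D0 G) H ->
  2 ^ (E ^ 2) <= #|V| -> #|V| * E <= 4 * #|edges H|.
Proof.
case: E => [|D Hs EV]; first by rewrite muln0.
set L := [set x | #|nbrs x| <= D].
have L2 : 2 * #|L| <= #|V|.
  apply: leq_trans EV.
  have DD : D.+1 <= 2 ^ D by exact: ltn_expl.
  (* The 1 pays for the factor 2 in front of [#|L|], and one D for [D.+1 <= 2 ^ D]. *)
  have -> : D.+1 ^ 2 = 1 + (D + D ^ 2) + D by rewrite -addn1 sqrnD; lia.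
  rewrite !expnD expn1 -[X in X <= _]muln1 leq_mul ?expn_gt0 // leq_mul2l /=.
  by apply: leq_trans (card_low_degree D Hs) _; rewrite leq_mul2r DD orbT.
have := sum_card_nbrs; rewrite (bigID (mem L)) /=.
have : #|~: L| * D.+1 <= \sum_(x | x \notin L) #|nbrs x|.
  rewrite -sum_nat_const big_mkcond /= [X in _ <= X]big_mkcond /=.
  by apply: leq_sum => x _; rewrite !inE -ltnNge; case: ifP.
have : #|V| * D.+1 <= 2 * (#|~: L| * D.+1).
  by rewrite mulnA leq_mul2r; have := cardsC L; lia.
move=> h1 h2 h3; apply: leq_trans h1 _;
  rewrite -[4]/(2 * 2) -mulnA leq_mul2l /=.
exact: leq_trans h2 (leq_trans (leq_addl _ _) h3).
Qed.

End Semisaturated.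

(** * Greedy completion of a free graph *)

(** S holds the pairs that may still be added. A free extension of [H0] with the most edges is
    saturated: a pair of S that creates no copy could be added, and any other pair keeps its copy
    from [H0]. *)
Lemma greedy_saturation (W V : finType) (F : eograph W) (H0 : eograph V)
    (S : {set {set V}}) :
  free F H0 ->
  (forall (e : {set V}) (e2 : #|e| = 2), e \notin edges H0 -> e \notin S ->
    exists2 phi : W -> V, is_copy F (add_first H0 e2) phi &
      exists2 f, f \in edges F & phi @: f = e) ->
  exists H : eograph V,
    [/\ free F H, semisaturated F H & #|edges H| <= #|edges H0| + #|S|].
Proof.
move=> H0free H0sat.
(* Each insertion shifts the labels, so only the order of the edges of [H0] is kept, not their
   labels. *)
pose extension (H : eograph V) := [/\ free F H, edges H0 \subset edges H,
  edges H \subset edges H0 :|: S & {in edges H0 &, forall e f,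
    lab H0 e < lab H0 f -> lab H e < lab H f}].
have size_ext H : extension H -> #|edges H| <= #|edges H0| + #|S|.
  case=> _ _ /subset_leq_card/leq_trans + _; apply.
  by rewrite cardsU leq_subr.
pose P k := `[< exists H, extension H /\ #|edges H| = k >].
have exP : exists k, P k.
  by exists #|edges H0|; apply/asboolP; exists H0; split=> //; split=> //;
    apply: subsetUl.
have bndP k : P k -> k <= #|edges H0| + #|S|.
  by move=> /asboolP[H [Hext <-]]; apply: size_ext.
case: (ex_maxnP exP bndP) => k /asboolP[H [Hext Hk]] maxk.
exists H; have [Hfree H0H HS Hlab] := Hext; split=> //; last exact: size_ext.
move=> e e2 eH; have eH0 : e \notin edges H0 by apply: contraNN eH;
  apply/subsetP.
have H0_neq f : f \in edges H0 -> (f == e) = false.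
  by move=> fH0; apply: contraNF eH0 => /eqP <-.
have [eS|eS] := boolP (e \in S); last first.
  (* This copy uses only e and edges of [H0]; in H these keep their order, and e still comes
     first. *)
  have [phi [phiI phiE phiL] phie] := H0sat e e2 eH0 eS.
  exists phi => //; split=> // [f /phiE|f g fF gF /(phiL _ _ fF gF)].
    by case/setU1P=> [->|/(subsetP H0H)]; [exact: setU11|exact: setU1r].
  move: (phiE _ fF) (phiE _ gF); rewrite /= /first_lab !inE.
  by do 2!case: eqVneq => //= _; move=> fH gH /(Hlab _ _ fH gH).
apply: contrapT => nocopy.
suff /maxk : P k.+1 by rewrite ltnn.
apply/asboolP; exists (add_first H e2); split; last by rewrite cardsU1 eH Hk.
split.
- move=> [phi cphi]; have [phiI phiE phiL] := cphi.
  have ne f : f \in edges F -> (phi @: f == e) = false.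
    by move=> fF; apply/eqP => fe; apply: nocopy; exists phi => //; exists f.
  apply: Hfree; exists phi; split=> // [f fF|f g fF gF fg].
    by have := phiE _ fF; rewrite in_setU1 ne.
  by have := phiL _ _ fF gF fg; rewrite /= /first_lab !ne.
- by apply: subset_trans H0H _; apply: subsetUr.
- by rewrite subUset HS andbT sub1set inE eS orbT.
- by move=> f g fH gH /(Hlab _ _ fH gH); rewrite /= /first_lab !H0_neq.
Qed.

(** * Relabelling the vertices by ordinals, as [sat_m] requires *)

Section Transport.
Variables (V : finType) (H : eograph V).

Definition rank_edges : {set {set 'I_#|V|}} :=
  [set enum_rank @: e | e : {set V} in edges H].
Definition rank_lab (e : {set 'I_#|V|}) := lab H (enum_val @: e).

Lemma enum_rankKset : cancel (fun e : {set V} => enum_rank @: e)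
  (fun e : {set 'I_#|V|} => enum_val @: e).
Proof.
move=> e; rewrite -imset_comp -[RHS]imset_id; apply: eq_imset => x /=.
exact: enum_rankK.
Qed.

Lemma enum_valKset : cancel (fun e : {set 'I_#|V|} => enum_val @: e)
  (fun e : {set V} => enum_rank @: e).
Proof.
move=> e; rewrite -imset_comp -[RHS]imset_id; apply: eq_imset => x /=.
exact: enum_valK.
Qed.

Fact rank_card : {in rank_edges, forall e : {set _}, #|e| = 2}.
Proof.
move=> e /imsetP[f fH ->]; rewrite card_imset; last exact: enum_rank_inj.
exact: (card_edge fH).
Qed.

Fact rank_inj : {in rank_edges &, injective rank_lab}.
Proof.
move=> e f /imsetP[e' eH ->] /imsetP[f' fH ->];
  rewrite /rank_lab !enum_rankKset.
by move/(lab_inj eH fH)->.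
Qed.

Definition rank_graph := EOGraph rank_card rank_inj.

Lemma mem_rank_edges e : (e \in rank_edges) = (enum_val @: e \in edges H).
Proof.
apply/imsetP/idP => [[f fH ->]|eH]; first by rewrite enum_rankKset.
by exists (enum_val @: e); rewrite ?enum_valKset.
Qed.

Lemma rank_free (W : finType) (F : eograph W) : free F H -> free F rank_graph.
Proof.
move=> Hfree [phi [phiI phiE phiL]]; apply: Hfree; exists (enum_val \o phi).
split=> [|e /phiE|e f eF fF /(phiL _ _ eF fF)].
- exact: inj_comp enum_val_inj phiI.
- by rewrite (imset_comp enum_val) /= mem_rank_edges.
- by rewrite !(imset_comp enum_val phi).
Qed.

Lemma rank_semisaturated (W : finType) (F : eograph W) :
  semisaturated F H -> semisaturated F rank_graph.
Proof.
move=> Hsat e e2; rewrite /= mem_rank_edges => eH.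
have e2' : #|enum_val @: e| = 2 by rewrite card_imset //; apply: enum_val_inj.
have [phi [phiI phiE phiL] [f fF fe]] := Hsat _ e2' eH.
exists (enum_rank \o phi); last first.
  by exists f; rewrite // (imset_comp enum_rank) fe enum_valKset.
have eqe (g : {set W}) :
  ((enum_rank \o phi) @: g == e) = (phi @: g == enum_val @: e).
  rewrite (imset_comp enum_rank) -[e in LHS]enum_valKset.
  exact: can_eq enum_rankKset _ _.
split=> [|g /phiE|g h gF hF /(phiL _ _ gF hF)].
- exact: inj_comp enum_rank_inj phiI.
- by rewrite !in_setU1 eqe (imset_comp enum_rank) /= mem_rank_edges
    enum_rankKset.
- by rewrite /= /first_lab !eqe !(imset_comp enum_rank phi) /= /rank_lab
    !enum_rankKset.
Qed.

End Transport.

Lemma sat_m_le (W V : finType) (F : eograph W) (H : eograph V) :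
  free F H -> semisaturated F H -> sat_m #|V| F <= #|edges H|.
Proof.
move=> Hfree Hsat; pose P m := exists H' : eograph 'I_#|V|,
  [/\ free F H', semisaturated F H' & #|edges H'| = m].
have PH : P #|edges H|.
  exists (rank_graph H); split; [exact: rank_free|exact: rank_semisaturated|].
  by rewrite card_imset //; apply: can_inj (@enum_rankKset V).
have [|_] := @nat_minP P; first by exists #|edges H|.
exact.
Qed.

(** * Discordant pairs of permutations *)

Lemma card_perm_lt k (s : {perm 'I_k}) i : #|[set j | s j < s i]| = s i.
Proof.
rewrite -(card_imset _ (@perm_inj _ s)).
have -> : s @: [set j | s j < s i] = [set l : 'I_k | l < s i].
  apply/setP => l; apply/imsetP/idP => [[j]|]; first by rewrite !inE => ? ->.
  by rewrite inE => li; exists (s^-1 l)%g; rewrite ?inE permKV.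
rewrite cardsE -sum1_card (eq_bigl (fun l : 'I_k => l < s i)) //.
by rewrite -(big_ord_widen k (fun=> 1)) ?sum1_card ?card_ord // ltnW.
Qed.

(** Without a discordant pair, s and t order ['I_k] alike; then s i and t i both count the same
    elements below i, so s = t. *)
Lemma perm_discordant k (s t : {perm 'I_k}) : s != t ->
  exists i j, (s i < s j) && (t j < t i).
Proof.
move=> st; apply: contrapT => noij; case/eqP: st.
have noij' i j : s i < s j -> t i < t j.
  move=> sij; rewrite ltn_neqAle leqNgt; apply/andP; split.
    by apply: contraTneq sij => /val_inj/perm_inj->; rewrite ltnn.
  by apply/negP => tji; apply: noij; exists i, j; rewrite sij.
apply/permP => i; apply/val_inj;
  rewrite /= -[LHS]card_perm_lt -[RHS]card_perm_lt.
apply: eq_card => j; rewrite !inE; apply/idP/idP => [/noij' //|tji].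
rewrite ltnNge leq_eqVlt; apply/negP => /orP[/eqP/val_inj/perm_inj ij|/noij'].
  by rewrite ij ltnn in tji.
by rewrite ltnNge (ltnW tji).
Qed.

(** * Upper bound: the hub graph and its completion *)

Lemma dunion_edge_inl (A B : finType) (F : eograph A) (G : eograph B) u z :
  [set inl u; z] \in edges (dunion F G) ->
  exists2 u', z = inl u' & [set u; u'] \in edges F.
Proof.
move=> /setUP[] /imsetP[e eE /setP eq]; last first.
  by have := eq (inl u); rewrite set21 => /esym/imsetP[].
have := eq z; rewrite set22 => /esym/imsetP[u' _ zu']; exists u' => //.
suff -> : [set u; u'] = e by [].
have inl_inj : injective (@inl A B) by move=> x y [].
by apply: (imset_inj inl_inj); rewrite imset_set2 -zu'; apply/setP.
Qed.

Lemma card_dunion_edges (A B : finType) (F : eograph A) (G : eograph B) :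
  #|edges (dunion F G)| = #|edges F| + #|edges G|.
Proof.
have inlI : injective (@inl A B) by move=> x y [].
have inrI : injective (@inr A B) by move=> x y [].
rewrite cardsU !card_imset; try exact: imset_inj.
rewrite (_ : _ :&: _ = set0) ?cards0 ?subn0 //; apply/setP => e; rewrite !inE.
apply/negP => /andP[/imsetP[f /card_edge f2 ->] /imsetP[g _ /setP fg]].
have /card_gt0P[x xf] : 0 < #|f| by rewrite f2.
by have := fg (inl x); rewrite imset_f // => /esym/imsetP[].
Qed.

Section HubGraph.
Variables (k m : nat) (p : 'I_m -> {perm 'I_k}).

Definition hub_edge (hx : 'I_k * 'I_m) : {set 'I_k + 'I_m} :=
  [set inl hx.1; inr hx.2].

(* On an edge, both sums have a single term. *)
Definition hub_lab (e : {set 'I_k + 'I_m}) : nat :=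
  \sum_(x | inr x \in e) \sum_(h | inl h \in e) (x * k + p x h).

Lemma hub_labE h x : hub_lab (hub_edge (h, x)) = x * k + p x h.
Proof.
rewrite /hub_lab (big_pred1 x) => [|y]; last by rewrite !inE.
by rewrite (big_pred1 h) // => i; rewrite !inE orbF.
Qed.

Fact hub_card :
  {in [set hub_edge hx | hx in setT], forall e : {set _}, #|e| = 2}.
Proof. by move=> e /imsetP[[h x] _ ->]; rewrite cards2. Qed.

Fact hub_inj : {in [set hub_edge hx | hx in setT] &, injective hub_lab}.
Proof.
move=> e f /imsetP[[h x] _ ->] /imsetP[[i y] _ ->]; rewrite !hub_labE => eq.
have k_gt0 : 0 < k by apply: leq_ltn_trans (ltn_ord h).
(* As [p x h < k], division of the label by k recovers x. *)
have xy : x = y.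
  by apply/val_inj; have := congr1 (divn^~ k) eq;
    rewrite !divnMDl // !divn_small // !addn0.
by move: eq; rewrite xy => /addnI/val_inj/perm_inj->.
Qed.

Definition hub_graph : eograph ('I_k + 'I_m)%type := EOGraph hub_card hub_inj.

Lemma card_hub_edges : #|edges hub_graph| <= k * m.
Proof.
by apply: leq_trans (leq_imset_card _ _) _; rewrite cardsT card_prod !card_ord.
Qed.

Lemma mem_hub_edges h x : hub_edge (h, x) \in edges hub_graph.
Proof. exact: imset_f. Qed.

Lemma hub_edge_bipartite a b : [set a; b] \in edges hub_graph ->
  (if a is inl _ then true else false) != (if b is inl _ then true else false).
Proof.
case/imsetP=> -[h x] _ /setP eq; move: (eq a) (eq b) (eq (inl h)) (eq (inr x)).
rewrite !inE !eqxx !orbT /=.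
by case: a {eq} => a; case: b.
Qed.

Variables (W : finType) (G : eograph W).

(** If a goes into [G], so does the edge [ab]; all later edges lie above it, hence in [G], which has
    too few edges. If a goes into the hub graph, the triangle a, b, v goes there too, against
    bipartiteness. *)
Lemma hub_free : free (dunion D0 G) (dunion hub_graph G).
Proof.
case=> phi [phiI phiE phiL]; pose q i := phi (inl i).
have inlE e (eD : e \in edges D0) := dunion_edge_inlI G eD.
have qE i j : [set i; j] \in edges D0 ->
    [set q i; q j] \in edges (dunion hub_graph G).
  by move/inlE/phiE; rewrite !imset_set2.
have abE := D0_edge_ab.
case qa : (q va) => [u|w]; last first.
  pose inrE (e : {set W}) : {set ('I_k + 'I_m) + W} := inr @: e.
  have phiG g :
    g \in edges (dunion D0 G) -> phi @: g \in [set inrE e | e in edges G].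
    move=> gE; case/setUP: (phiE _ gE) => // /imsetP[g' g'E gg'].
    case/setUP: (phiE _ (inlE _ abE)) => /imsetP[e eE].
      rewrite !imset_set2 -/(q va) qa => /setP/(_ (inr w)).
      by rewrite set21 => /esym/imsetP[].
    move=> eab.
    have : lab (dunion D0 G) (inl @: [set va; vb]) <= lab (dunion D0 G) g.
      by rewrite [X in X <= _]/= dunion_inl // /D0 /= eqxx.
    rewrite leq_eqVlt => /orP[/eqP/(lab_inj (inlE _ abE) gE) abg|].
      by rewrite -abg eab imset_f.
    move/(phiL _ _ (inlE _ abE) gE);
      rewrite eab gg' /= dunion_inl ?dunion_inr //.
    by rewrite ltnNge (leq_trans (ltnW (lab_lt_bound g'E)) (leq_addr _ _)).
  have : #|edges (dunion D0 G)| <= #|edges G|.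
    apply: leq_trans (leq_imset_card inrE _).
    rewrite -(card_imset _ (imset_inj phiI)); apply/subset_leq_card.
    by apply/subsetP => g /imsetP[g' g'E ->]; apply: phiG.
  rewrite card_dunion_edges -[X in _ <= X]add0n leq_add2r leqn0 cards_eq0.
  by move/eqP/setP/(_ [set va; vb]); rewrite abE inE.
have [avE bvE] : [set va; vv] \in edges D0 /\ [set vb; vv] \in edges D0.
  by rewrite !inE !eqxx !orbT.
have := qE _ _ abE; rewrite qa => /dunion_edge_inl[ub qb /hub_edge_bipartite].
have := qE _ _ avE; rewrite qa => /dunion_edge_inl[uv qv /hub_edge_bipartite].
have := qE _ _ bvE; rewrite qb => /dunion_edge_inl[uv']; rewrite qv => -[<-].
by move/hub_edge_bipartite; case: u {qa} => ?; case: ub {qb} => ?;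
  case: uv {qv}.
Qed.

Definition top_pair (x y : 'I_m) : {set ('I_k + 'I_m) + W} :=
  [set inl (inr x); inl (inr y)].

Definition diamond (x y : 'I_m) (i j : 'I_k) (t : 'I_4 + W) :
    ('I_k + 'I_m) + W :=
  match t with
  | inl s => inl (tnth [tuple inr x; inr y; inl i; inl j] s)
  | inr w => inr w
  end.

(** The order is: the new edge xy, then xi and xj in the block of x, then yj and yi in the block of
    y, then [G]. *)
Lemma diamond_copy x y i j (e2 : #|top_pair x y| = 2) :
    x < y -> p x i < p x j -> p y j < p y i ->
  is_copy (dunion D0 G) (add_first (dunion hub_graph G) e2) (diamond x y i j).
Proof.
move=> xy pxij pyji; set phi := diamond x y i j; set e0 := top_pair x y in e2 *.
pose q s := tnth [tuple inr x; inr y; inl i; inl j] s : 'I_k + 'I_m.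
have phi_inl (e : {set 'I_4}) : phi @: (inl @: e) = inl @: (q @: e).
  by rewrite -(imset_comp phi) -(imset_comp _ q).
have phi_inr (e : {set W}) : phi @: (inr @: e) = inr @: e
  by rewrite -(imset_comp phi).
have ne h z : inl @: (hub_edge (h, z)) != e0.
  apply/eqP => /setP/(_ (inl (inl h))); rewrite imset_set2 !inE.
  by rewrite eqxx.
have q_ab : q @: [set va; vb] = [set inr x; inr y] by rewrite imset_set2.
have q_av : q @: [set va; vv] = hub_edge (i, x) by rewrite imset_set2 setUC.
have q_aw : q @: [set va; vw] = hub_edge (j, x) by rewrite imset_set2 setUC.
have q_bw : q @: [set vb; vw] = hub_edge (j, y) by rewrite imset_set2 setUC.
have q_bv : q @: [set vb; vv] = hub_edge (i, y) by rewrite imset_set2 setUC.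
have qE e : e \in edges D0 -> e = [set va;
  vb] \/ exists h z, q @: e = hub_edge (h, z).
  rewrite !inE => /or4P[/eqP->|/eqP->|/eqP->|/orP[]/eqP->]; first by left.
  - by right; exists i, x.
  - by right; exists j, x.
  - by right; exists j, y.
  - by right; exists i, y.
set H := dunion hub_graph G.
have e0E : inl @: (q @: [set va; vb]) = e0 by rewrite q_ab imset_set2.
have lab_e0 : first_lab H e0 e0 = 0 by rewrite /first_lab eqxx.
have lab_hub h z : first_lab H e0 (inl @: hub_edge (h, z)) = (z * k + p z h).+1.
  by rewrite /first_lab (negPf (ne h z)) /= dunion_inl ?mem_hub_edges //=
    hub_labE.
have ne_inr g : g \in edges G -> inr @: g != e0.
  by move=> gG; apply/eqP => /setP/(_ (inl (inr x)));
    rewrite set21 => /imsetP[].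
have lab_inr g : g \in edges G ->
    first_lab H e0 (inr @: g) = (lab_bound hub_graph + lab G g).+1.
  by move=> gG; rewrite /first_lab (negPf (ne_inr g gG)) /= dunion_inr.
have lab_inl e g : e \in edges D0 -> g \in edges G ->
    first_lab H e0 (inl @: (q @: e)) < first_lab H e0 (inr @: g).
  move=> eD gG; rewrite lab_inr //; case: (qE _ eD) => [->|[h [z ->]]].
    by rewrite e0E lab_e0.
  rewrite lab_hub ltnS; apply: leq_trans (leq_addr _ _).
  by rewrite -hub_labE; apply: (@lab_lt_bound _ hub_graph);
    apply: mem_hub_edges.
split.
- have xy' : inr x != inr y :> 'I_k + 'I_m by apply: contraTneq xy => -[->];
    rewrite ltnn.
  have ij : inl i != inl j :> 'I_k + 'I_m by apply: contraTneq pxij => -[->];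
    rewrite ltnn.
  have qI : injective q by apply/tuple_uniqP;
    rewrite /= !inE (negPf xy') (negPf ij).
  by move=> [s|w] [s'|w'] //= [] => [/qI|] ->.
- move=> g /setUP[] /imsetP[e eE ->].
    rewrite phi_inl; case: (qE _ eE) => [->|[h [z ->]]];
      first by rewrite e0E setU11.
    by apply/setU1r/setUP; left; apply/imset_f/mem_hub_edges.
  by rewrite phi_inr; apply/setU1r/setUP; right; apply: imset_f.
- have k_gt0 := leq_ltn_trans (leq0n _) (ltn_ord i).
  move=> g g' /setUP[] /imsetP[e eE ->] /setUP[] /imsetP[f fE ->] /=;
    rewrite ?dunion_inl ?dunion_inr ?phi_inl ?phi_inr //.
  + apply: (@D0_lab_mono (fun e =>
      first_lab H e0 (inl @: (q @: e)))) eE fE => /=;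
      rewrite ?e0E ?lab_e0 ?q_av ?q_aw ?q_bw ?q_bv ?lab_hub ?ltnS ?ltn_add2l //.
    (* Here xj precedes yj: the block of x ends before [x.+1 * k], and x < y. *)
    apply: (@leq_trans (x.+1 * k)); first by rewrite mulSn addnC ltn_add2r.
    by apply: leq_trans (leq_addr _ _); rewrite leq_mul2r xy orbT.
  + by move=> _; apply: lab_inl.
  + by rewrite ltnNge (leq_trans (ltnW (lab_lt_bound fE))) ?leq_addr.
  + by rewrite ltn_add2l !lab_inr // ltnS ltn_add2l.
Qed.

Hypothesis p_inj : injective p.

Lemma hub_saturated x y (e2 : #|top_pair x y| = 2) :
  exists2 phi, is_copy (dunion D0 G) (add_first (dunion hub_graph G) e2) phi &
    exists2 f, f \in edges (dunion D0 G) & phi @: f = top_pair x y.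
Proof.
wlog xy : x y e2 / x < y.
  move=> IH; have [xy|yx|/val_inj xy] := ltngtP x y; first exact: IH.
    have yxE : top_pair x y = top_pair y x by rewrite /top_pair setUC.
    by rewrite yxE in e2 *; apply: IH.
  by exfalso; move: e2; rewrite xy /top_pair setUid cards1.
have pxy : p x != p y by rewrite (inj_eq p_inj); case: eqVneq xy => // ->;
  rewrite ltnn.
have [i [j /andP[pxij pyji]]] := perm_discordant pxy.
exists (diamond x y i j); first exact: diamond_copy.
exists (inl @: [set va; vb]); last by rewrite !imset_set2.
exact/dunion_edge_inlI/D0_edge_ab.
Qed.

(** Only pairs meeting U, the hubs and the vertices of [G], escape [hub_saturated]. The last term
    bounds their number, and the greedy completion may add all of them. *)
Lemma sat_m_hub_le :
  sat_m (k + m + #|W|) (dunion D0 G) <=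
    k * m + #|edges G| + (k + #|W|) * (k + m + #|W|).
Proof.
have cV : #|{: ('I_k + 'I_m) + W}| = k + m + #|W|
  by rewrite !card_sum !card_ord.
pose top (x : 'I_m) : ('I_k + 'I_m) + W := inl (inr x).
have top_inj : injective top by move=> x y [].
pose U := ~: [set top x | x : 'I_m].
pose S := [set [set uz.1; uz.2] | uz in setX U setT].
have cU : #|U| = k + #|W|.
  have := cardsC [set top x | x : 'I_m].
  by rewrite -/U card_imset // card_ord cV; lia.
have cS : #|S| <= (k + #|W|) * (k + m + #|W|).
  by apply: leq_trans (leq_imset_card _ _) _; rewrite cardsX cardsT cU cV.
have [|H [Hfree Hsat cH]] :=
    @greedy_saturation _ _ (dunion D0 G) (dunion hub_graph G) S hub_free.
  move=> e e2 _; have /eqP/cards2P[a [b [_ eab]]] := e2; subst e.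
  have [aU|aU] := boolP (a \in U).
    by case/negP; apply/imsetP; exists (a, b); rewrite // in_setX aU inE.
  have [bU|bU] := boolP (b \in U).
    by case/negP; rewrite setUC; apply/imsetP; exists (b, a);
      rewrite // in_setX bU inE.
  move: aU bU; rewrite !in_setC !negbK => /imsetP[x _ xa] /imsetP[y _ yb] _;
    subst a b.
  exact: hub_saturated.
rewrite -cV; apply: leq_trans (sat_m_le Hfree Hsat) (leq_trans cH _).
by rewrite card_dunion_edges leq_add ?leq_add2r ?card_hub_edges ?cV.
Qed.
End HubGraph.

(** * Choice of the parameters k and E *)

Lemma sat_m_upper (W : finType) (G : eograph W) n k :
  n <= k`! -> k + #|W| <= n ->
  sat_m n (dunion D0 G) <= (k * 2 + #|W|) * n + #|edges G|.
Proof.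
move=> nk kn; set m := n - (k + #|W|).
have mk : m <= #|{: {perm 'I_k}}| by rewrite card_Sn (leq_trans (leq_subr _ _)).
pose p (x : 'I_m) : {perm 'I_k} := enum_val (widen_ord mk x).
have p_inj : injective p by move=> x y /enum_val_inj [] /val_inj.
have := sat_m_hub_le G p_inj; have -> : k + m + #|W| = n by lia.
by move/leq_trans; apply; nia.
Qed.

Lemma exists_perm_degree n : 8 <= n -> exists k h,
  [/\ n <= k`!, 0 < k, k * 2 <= n, k <= h * 2 + 2 & h ^ h <= n].
Proof.
move=> n8; have exk : exists k, n <= k`! by exists n; apply: fact_geq.
case: (ex_minnP exk) => -[|j] nj jmin; first by have := leq_trans n8 nj.
exists j.+1, j./2; split=> //.
- suff /jmin : n <= (n./2)`! by have := odd_double_half n; lia.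
  (* The extra 1 covers odd n. *)
  have fact_large i : (i.+4).*2.+1 <= (i.+4)`!.
    by elim: i => // i IH; rewrite factS; nia.
  have n4 : 4 <= n./2 by rewrite (half_leq n8).
  apply: leq_trans (leq_trans (fact_large (n./2 - 4)) _).
    by have := odd_double_half n; lia.
  by rewrite -addn4 subnK.
- by have := odd_double_half j; lia.
- have h_fact i : j./2 ^ i <= (j./2 + i)`!.
    elim: i => [|i IH]; first by rewrite fact_gt0.
    by rewrite addnS expnS factS leq_mul // leqW // leq_addr.
  have jn : j`! <= n by rewrite leqNgt; apply/negP => /ltnW/jmin; rewrite ltnn.
  apply: leq_trans (h_fact _) (leq_trans (leq_fact _) jn).
  by rewrite addnn -[leqRHS]odd_double_half leq_addl.
Qed.

(** E is the integer part of the square root of the binary logarithm of n. *)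
Lemma exists_exp_square n : 2 <= n -> exists2 E,
  0 < E & 2 ^ (E ^ 2) <= n < 2 ^ (E.+1 ^ 2).
Proof.
move=> n2; have exE : exists E, 2 ^ (E ^ 2) <= n by exists 1.
have bndE E : 2 ^ (E ^ 2) <= n -> E <= n.
  move=> En; apply: leq_trans En; apply/ltnW/(leq_trans (ltn_expl E (ltnSn 1))).
  by rewrite leq_exp2l //; case: E => // E; rewrite expnS leq_pmulr.
case: (ex_maxnP exE bndE) => E En Emax; exists E; first exact: (Emax 1).
by rewrite En ltnNge; apply/negP => /Emax; rewrite ltnn.
Qed.

(* Real estimates and the asymptotic statement *)
From HB Require Import structures.
From mathcomp Require Import all_boot all_order all_algebra.
From mathcomp Require Import all_classical all_reals all_analysis.
From mathcomp Require Import lra.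
Import Order.TTheory GRing.Theory Num.Theory.
Import numFieldNormedType.Exports.
Local Open Scope classical_set_scope.
Local Open Scope ring_scope.

Lemma sqrt_ln_le (R : realType) n E :
  (0 < E)%N -> (n < 2 ^ (E.+1 ^ 2))%N -> Num.sqrt (ln n%:R) <= 2 * E%:R :> R.
Proof.
move=> E0 nE; have [->|n0] := posnP n.
  (* At n = 0 the logarithm takes its default value 0. *)
  by rewrite ln0 // sqrtr0 mulr_ge0.
have lnn : ln n%:R <= E.+1%:R ^+ 2 :> R.
  rewrite -[leRHS]expRK ler_ln ?posrE ?expR_gt0 ?ltr0n //.
  rewrite -natrX -[_%:R in leRHS]mul1r expRM_natr.
  apply: (@le_trans _ _ (2 ^+ (E.+1 ^ 2)));
    first by rewrite -natrX ler_nat ltnW.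
  rewrite lerXn2r ?nnegrE ?expR_ge0 //.
  (* This is 2 <= e, which replaces the binary by the natural logarithm. *)
  by have := expR_ge1Dx (1 : R); lra.
apply: le_trans (ler_wsqrtr lnn) _; rewrite sqrtr_sqr ger0_norm //.
by rewrite -natrM ler_nat; lia.
Qed.

(* With t = (ln L) / 2, either t <= ln h, and then h t <= h ln h <= L,
   or h < exp t, and then h t <= (exp t) ^ 2 = L. *)
Lemma self_power_le (R : realType) n h : (h ^ h <= n)%N ->
  1 < ln n%:R :> R -> h%:R * (ln (ln n%:R) / 2) <= ln n%:R :> R.
Proof.
move=> hn; set L : R := ln n%:R => L1; set t := ln L / 2.
have t0 : 0 < t by rewrite divr_gt0 // ln_gt0.
have LE : L = expR t * expR t.
  by rewrite -expRD -mulr2n -mulr_natr divfK // lnK // posrE; lra.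
have [->|h0] := posnP h; first by rewrite mul0r; lra.
have hR : 0 < h%:R :> R by rewrite ltr0n.
have [th|ht] := leP t (ln h%:R).
  apply: (@le_trans _ _ (h%:R * ln h%:R)); first by rewrite ler_pM2l.
  rewrite mulr_natl -lnXn // ler_ln ?posrE ?exprn_gt0 // -?natrX ?ler_nat //.
  by rewrite ltr0n (leq_trans _ hn) // expn_gt0 h0.
rewrite LE ler_pM // ?(ltW t0) //.
  by rewrite -[leLHS]lnK ?posrE // ler_expR ltW.
by have := expR_ge1Dx t; lra.
Qed.

Theorem corollary25 (R : realType) (W : finType) (G : eograph W) :
  [/\ (fun n : nat => (ssat_m n (dunion D0 G))%:R : R)
        =Omega_\oo (fun n : nat => n%:R * Num.sqrt (ln n%:R) : R),
      (forall n : nat, (ssat_m n (dunion D0 G) <= sat_m n (dunion D0 G))%N) &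
      (fun n : nat => (sat_m n (dunion D0 G))%:R : R)
        =O_\oo (fun n : nat => n%:R * (ln n%:R / ln (ln n%:R)) : R)].
Proof.
split.
(* The 8 is the 4 of [semisaturated_edges_ge] times the 2 of [sqrt_ln_le]. *)
- rewrite eqOmegaE eqOmegaO; apply/eqO_exP; exists 8 => //.
  near=> n.
  have n2 : (2 <= n)%N by near: n; exact: nbhs_infty_ge.
  have [E E0 /andP[En nE]] := exists_exp_square n2.
  have [H [Hsat <-]] := ssat_m_attained n (dunion D0 G).
  have := semisaturated_edges_ge Hsat; rewrite card_ord => /(_ _ En) nH.
  rewrite !ger0_norm ?mulr_ge0 ?sqrtr_ge0 //.
  apply: (@le_trans _ _ (n%:R * (2 * E%:R))).
    by rewrite ler_wpM2l // sqrt_ln_le.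
  by rewrite -!natrM ler_nat; lia.
- move=> n; apply: ssat_m_le_sat_m; apply/set0Pn.
  by exists (inl @: [set va; vb]%SET); apply/dunion_edge_inlI/D0_edge_ab.
(* For n, k >= 1, c n k dominates the bound of [sat_m_upper]; the 8 bounds k by L / ln L. *)
- apply/eqO_exP; set c := (2 + #|W| + #|edges G|)%N.
  exists (8 * c%:R); first by rewrite mulr_gt0 // ltr0n.
  near=> n.
  have n8 : (8 <= n)%N by near: n; exact: nbhs_infty_ge.
  have nW : (2 * #|W| <= n)%N by near: n; exact: nbhs_infty_ge.
  have L1 : 1 < ln n%:R :> R.
    rewrite -[ltLHS]expRK ltr_ln ?posrE ?expR_gt0 ?ltr0n ?(leq_trans _ n8) //.
    by near: n; exact: nbhs_infty_gtr.
  have [k [h [nk k0 kn kh hn]]] := exists_perm_degree n8.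
  set L := ln n%:R in L1 *.
  have lnL : 0 < ln L by rewrite ln_gt0.
  (* From k <= 2h + 2, h ln L <= 2L and ln L <= L one gets k ln L <= 6L. *)
  have kL : k%:R <= 8 * (L / ln L).
    have hL := self_power_le hn L1.
    have lnL_le : ln L <= L.
      have : -1 < L - 1 by lra.
      by move/le_ln1Dx; rewrite [X in ln X](_ : _ = L); lra.
    rewrite mulrA ler_pdivlMr //.
    have : k%:R * ln L <= (h%:R * 2 + 2) * ln L.
      by rewrite ler_pM2r // -!(natrM, natrD) ler_nat.
    by rewrite -/L in hL; lra.
  rewrite !ger0_norm ?mulr_ge0 ?invr_ge0 ?(ltW lnL) ?(le_trans ler01 (ltW L1))
    //.
  apply: (@le_trans _ _ (c%:R * n%:R * k%:R)).
    rewrite -!natrM ler_nat; apply: leq_trans (sat_m_upper G nk _) _;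
      first by lia.
    have Wk : (#|W| * n <= #|W| * n * k)%N by exact: leq_pmulr.
    have Gk : (#|edges G| <= #|edges G| * (n * k))%N.
      by rewrite leq_pmulr // muln_gt0 k0 (leq_trans _ n8).
    by rewrite /c; nia.
  rewrite [leRHS](_ : _ = c%:R * n%:R * (8 * (L / ln L))); last by lra.
  by rewrite ler_wpM2l // mulr_ge0.
Unshelve. all: by end_near.
Qed.
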